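(* Let $i\in I^{\mathrm{re}}$, $j\in I$, $i\ne j$. Let $m\in\mathbb{Z}_{>0}$, $n\in\mathbb{Z}_{\ge0}$ with $m>-a_{ij}n$. If $j\in I^{\mathrm{im}}$, let $\mathbf{c}=(c_1,\dots,c_b)$ be a tuple of positive integers with $\sum_{t=1}^bc_t=n$ and put $a_{j,\mathbf{c}}=\prod_{t=1}^b a_{jc_t}=a_{jc_1}\cdots a_{jc_b}$; if $j\in I^{\mathrm{re}}$, put $a_{j,\mathbf{c}}=a_j^{(n)}$. Define $$F_{i,j,m,n,\mathbf{c}}=\sum_{r+s=m}(-1)^{r}(-1)^{nr\,p(i)p(j)+\binom r2p(i)}\bigl((-1)^{p(i)}q_i\bigr)^{-r(na_{ij}+m-1)}a_i^{(r)}\,a_{j,\mathbf{c}}\,a_i^{(s)},$$ where $r,s\ge 0$. Then $F_{i,j,m,n,\mathbf{c}}=0$ in $U^+=F/\mathscr{R}$.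
   Context: Let $I$ be a finite or countably infinite index set and $A=(a_{ij})_{i,j\in I}$ a symmetrizable Borcherds–Cartan matrix: integer entries, $a_{ii}\in\{2,0,-2,-4,\dots\}$, $a_{ij}\le 0$ for $i\ne j$, and positive integers $d_i$ with $d_ia_{ij}=d_ja_{ji}$ are fixed. Let $I=I_{\bar0}\sqcup I_{\bar1}$ with $a_{ij}\in2\mathbb{Z}$ for all $i\in I_{\bar1}$, $j\in I$; set $p(i)=0$ for $i\in I_{\bar0}$, $p(i)=1$ for $i\in I_{\bar1}$. Put $I^{\mathrm{re}}=\{i:a_{ii}=2\}$, $I^{\mathrm{im}}=\{i:a_{ii}\le0\}$, $I^\infty=(I^{\mathrm{re}}\times\{1\})\sqcup(I^{\mathrm{im}}\times\mathbb{Z}_{>0})$ (write $i$ for $(i,1)$), and $p(li)\in\{0,1\}$ with $p(li)\equiv l\,p(i)\pmod 2$. The root lattice is $Q=\bigoplus_{i\in I}\mathbb{Z}\alpha_i$ with symmetric form $(\alpha_i,\alpha_j)=d_ia_{ij}$. Set $q_i=q^{d_i}$. $F$ is the free associative unital $\mathbb{Q}(q)$-algebra on generators $a_{il}$, $(i,l)\in I^\infty$, with parity $p(a_{il})=p(li)$ and weight $|a_{il}|=l\alpha_i$. $F\otimes F$ is an algebra with product $(x_1\otimes x_2)(x_3\otimes x_4)=(-1)^{p(x_2)p(x_3)}q^{(|x_2|,|x_3|)}x_1x_3\otimes x_2x_4$ (homogeneous elements), and $\varrho:F\to F\otimes F$ is the algebra homomorphism with $\varrho(a_{il})=a_{il}\otimes1+1\otimes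 a_{il}$. $(\cdot,\cdot)$ is the unique bilinear form on $F$ with $(1,1)=1$, $(a_{il},a_{jk})=\delta_{ij}\delta_{lk}(1-(-1)^{p(li)}q_i^{2l})^{-1}$, $(x,yy')=(\varrho(x),y\otimes y')$, $(xx',y)=(x\otimes x',\varrho(y))$, where $(x_1\otimes x_2,x_3\otimes x_4)=(x_1,x_3)(x_2,x_4)$; it is symmetric, and its radical $\mathscr{R}$ is a two-sided ideal. $U^+=F/\mathscr{R}$; the image of $a_{il}$ is again denoted $a_{il}$. For $i\in I^{\mathrm{re}}$: $[s]_i=\dfrac{((-1)^{p(i)}q_i)^s-q_i^{-s}}{(-1)^{p(i)}q_i-q_i^{-1}}$, $[n]_i^!=\prod_{s=1}^n[s]_i$, $a_i^{(n)}=a_i^n/[n]_i^!$ for $n\ge0$ and $a_i^{(n)}=0$ for $n<0$. *)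

(* Defs.v *)
From HB Require Import structures.
From mathcomp Require Import all_boot all_order all_algebra.
From mathcomp Require Import finmap.
From mathcomp.multinomials Require Import monalg.
From mathcomp Require boolp.

Set Implicit Arguments.
Unset Strict Implicit.
Unset Printing Implicit Defensive.

Import Order.TTheory GRing.Theory Num.Theory.
Local Open Scope ring_scope.
Local Open Scope quotient_scope.

(* Locked: comparing distinct << k >> otherwise unfolds finite maps. *)
HB.lock Definition basis (R : comNzRingType) (K : choiceType) (k : K)
  : {malg R[K]} := << k >>.
Arguments basis {R K} k.

(* The linear map defined on the free module {malg R[K]} by its values f on
   the basis K. *)
HB.lock Definition linext (R : comNzRingType) (K : choiceType) (V : lmodType R)
    (f : K -> V) (g : {malg R[K]}) : V :=
  \sum_(k <- msupp g) g@_k *: f k.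
Arguments linext {R K V} f g.

Section LinearExtension.
Context (R : comNzRingType) (K : choiceType) (V : lmodType R).

Lemma linextEw (f : K -> V) (d : {fset K}) g : (msupp g `<=` d)%fset ->
  linext f g = \sum_(k <- d) g@_k *: f k.
Proof.
move=> le; rewrite linext.unlock [LHS](big_fset_incl _ le) => //= x xd /mcoeff_outdom ->.
by rewrite scale0r.
Qed.

Lemma linext_is_linear (f : K -> V) : linear (linext f).
Proof.
move=> c x y; set d := (msupp x `|` msupp y)%fset.
have le1 : (msupp x `<=` d)%fset by apply: fsubsetUl.
have le2 : (msupp y `<=` d)%fset by apply: fsubsetUr.
have le3 : (msupp (c *: x + y) `<=` d)%fset.
  apply: fsubset_trans (msuppD_le _ _) _; rewrite fsubUset le2 andbT.
  exact: fsubset_trans (msuppZ_le _ _) le1.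
rewrite !(@linextEw f d) // scaler_sumr -big_split /=; apply: eq_bigr => k _.
by rewrite mcoeffD mcoeffZ scalerDl scalerA.
Qed.

HB.instance Definition _ (f : K -> V) :=
  GRing.isLinear.Build R {malg R[K]} V *:%R (linext f) (linext_is_linear f).

Lemma linextU (f : K -> V) k : linext f (basis k) = f k.
Proof.
rewrite basis.unlock (@linextEw _ [fset k]%fset) ?msuppU_le //.
by rewrite big_seq_fset1 mcoeffUU scale1r.
Qed.

Lemma eq_linext (f1 f2 : K -> V) : f1 =1 f2 -> linext f1 =1 linext f2.
Proof. by move=> e g; rewrite linext.unlock; apply: eq_bigr => k _; rewrite e. Qed.

Lemma malg_lin_ind (P : {malg R[K]} -> Prop) :
    P 0 -> (forall c x y, P x -> P y -> P (c *: x + y)) ->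
  (forall k, P (basis k)) -> forall x, P x.
Proof.
move=> P0 PD PU x; rewrite (monalgE x).
elim/big_rec: _ => // k y _ Py.
suff -> : << x@_k *g k >> = x@_k *: basis k by apply: PD.
by rewrite basis.unlock; apply/malgP=> k'; rewrite mcoeffZ !mcoeffU mulrnAr mulr1.
Qed.

End LinearExtension.

Section BilinearExtension.
Context (R : comNzRingType) (K K' : choiceType) (V : lmodType R).
Implicit Types (f : K -> K' -> V).

Definition linext2 f (x : {malg R[K]}) (y : {malg R[K']}) : V :=
  linext (fun k => linext (f k) y) x.

Lemma linext2_is_bilinear f : bilinear_for *:%R *:%R (linext2 f).
Proof.
split=> [y|x] c u v /=; first exact: linearP.
rewrite /linext2 !(linextEw _ (fsubset_refl (msupp x))).
rewrite scaler_sumr -big_split /=; apply: eq_bigr => k _.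
by rewrite linearP scalerDr !scalerA mulrC.
Qed.

HB.instance Definition _ f :=
  bilinear_isBilinear.Build R _ _ V *:%R *:%R (linext2 f)
    (linext2_is_bilinear f).

Lemma linext2U f k k' : linext2 f (basis k) (basis k') = f k k'.
Proof. by rewrite /linext2 !linextU. Qed.

End BilinearExtension.

Lemma malg_scaleAr (R : comNzRingType) (M : monomType) c (x y : {malg R[M]}) :
  c *: (x * y) = x * (c *: y).
Proof.
apply/malgP=> k; rewrite mcoeffZ mcoeffMl.
rewrite (mcoeffMlw k (fsubset_refl (msupp x)) (msuppZ_le c y)) mulr_sumr.
apply: eq_bigr => u _; rewrite mulr_sumr; apply: eq_bigr => v _.
by rewrite mcoeffZ mulrnAr mulrCA.
Qed.

(* The library makes {quot J} a ring only over commutative rings. *)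
Section QuotientAlgebra.
Context (R : comNzRingType) (A : algType R) (J : zmodClosed A).
Context (JMl : forall x y : A, x \in J -> y * x \in J).
Context (JMr : forall x y : A, x \in J -> x * y \in J).
Context (J1 : 1 \notin J).
Local Notation Q := (Quotient.quot J).
Local Notation pi := (\pi_Q : A -> Q).

Definition quot_one : Q := pi 1.
Definition quot_mul (x y : Q) : Q := pi (repr x * repr y).
Definition quot_scale (c : R) (x : Q) : Q := pi (c *: repr x).

Lemma quot_piP x y : x - y \in J <-> pi x = pi y.
Proof. by rewrite Quotient.idealrBE; split=> /eqP. Qed.

Lemma quot_reprP x : repr (pi x) - x \in J.
Proof. by apply/quot_piP; rewrite reprK. Qed.

Lemma quot_piM x y : pi (x * y) = quot_mul (pi x) (pi y).
Proof.
apply/esym/quot_piP; rewrite -(subrKA (repr (pi x) * y)) -mulrBr -mulrBl.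
by apply: rpredD; [apply: JMl | apply: JMr]; apply: quot_reprP.
Qed.

Lemma quot_piZ c x : pi (c *: x) = quot_scale c (pi x).
Proof.
apply/esym/quot_piP; rewrite -scalerBr -[_ - x]mul1r scalerAl.
by apply: JMl; apply: quot_reprP.
Qed.

Lemma quot_piD x y : pi (x + y) = pi x + pi y.
Proof. by rewrite !piE. Qed.

Lemma quot_mulA : associative quot_mul.
Proof.
elim/quotW=> x; elim/quotW=> y; elim/quotW=> z.
by rewrite -(quot_piM y z) -(quot_piM x y) -!quot_piM mulrA.
Qed.

Lemma quot_mul1l : left_id quot_one quot_mul.
Proof. by elim/quotW=> x; rewrite -quot_piM mul1r. Qed.

Lemma quot_mul1r : right_id quot_one quot_mul.
Proof. by elim/quotW=> x; rewrite -quot_piM mulr1. Qed.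

Lemma quot_mulDl : left_distributive quot_mul +%R.
Proof.
elim/quotW=> x; elim/quotW=> y; elim/quotW=> z.
by rewrite -quot_piD -(quot_piM x z) -(quot_piM y z) -quot_piM -quot_piD mulrDl.
Qed.

Lemma quot_mulDr : right_distributive quot_mul +%R.
Proof.
elim/quotW=> x; elim/quotW=> y; elim/quotW=> z.
by rewrite -quot_piD -(quot_piM x y) -(quot_piM x z) -quot_piM -quot_piD mulrDr.
Qed.

Lemma quot_one_neq0 : quot_one != 0.
Proof.
apply: contraNneq J1 => e1; rewrite -[1]subr0; apply/quot_piP.
by rewrite [LHS]e1 !piE.
Qed.

Lemma quot_scaleA b c x : quot_scale b (quot_scale c x) = quot_scale (b * c) x.
Proof. by elim/quotW: x => x; rewrite -(quot_piZ c x) -!quot_piZ scalerA. Qed.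

Lemma quot_scale1 : left_id 1 quot_scale.
Proof. by elim/quotW=> x; rewrite -quot_piZ scale1r. Qed.

Lemma quot_scaleDr : right_distributive quot_scale +%R.
Proof.
move=> c; elim/quotW=> x; elim/quotW=> y.
by rewrite -quot_piD -(quot_piZ c x) -(quot_piZ c y) -quot_piZ -quot_piD scalerDr.
Qed.

Lemma quot_scaleDl x : {morph quot_scale^~ x : b c / b + c}.
Proof.
by elim/quotW: x => x b c; rewrite -!quot_piZ -quot_piD scalerDl.
Qed.

Lemma quot_scaleAl c x y :
  quot_scale c (quot_mul x y) = quot_mul (quot_scale c x) y.
Proof.
elim/quotW: x => x; elim/quotW: y => y.
by rewrite -(quot_piM x y) -(quot_piZ c x) -quot_piZ -quot_piM scalerAl.
Qed.

Lemma quot_scaleAr c x y :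
  quot_scale c (quot_mul x y) = quot_mul x (quot_scale c y).
Proof.
elim/quotW: x => x; elim/quotW: y => y.
by rewrite -(quot_piM x y) -(quot_piZ c y) -quot_piZ -quot_piM scalerAr.
Qed.

End QuotientAlgebra.

(* [cartan], [symmetrizer] and [parity] are a_ij, d_i and p(i). *)
Record borcherds_cartan (I : countType) := BorcherdsCartan {
  cartan :> I -> I -> int;
  symmetrizer : I -> nat;
  parity : I -> bool;
  cartan_diag : forall i,
    cartan i i = 2 \/ cartan i i <= 0 /\ (2 %| cartan i i)%Z;
  cartan_offdiag : forall i j, i != j -> cartan i j <= 0;
  symmetrizer_gt0 : forall i, (0 < symmetrizer i)%N;
  cartan_sym : forall i j,
    (symmetrizer i)%:Z * cartan i j = (symmetrizer j)%:Z * cartan j i;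
  cartan_even : forall i j, parity i -> (2 %| cartan i j)%Z
}.

Section BorcherdsSuperalgebra.
Context (I : countType) (D : borcherds_cartan I).
Local Notation d := (symmetrizer D).
Local Notation p := (parity D).

Definition real_index (i : I) : bool := D i i == 2.
Definition imaginary_index (i : I) : bool := D i i <= 0.

(* The index set I^infty. *)
Definition is_letter (x : I * nat) : bool :=
  real_index x.1 && (x.2 == 1%N) || imaginary_index x.1 && (0 < x.2)%N.

Definition letter := {x : I * nat | is_letter x}.
Definition letter_index (x : letter) : I := (val x).1.
Definition letter_level (x : letter) : nat := (val x).2.
Definition letter_parity (x : letter) : bool := odd (letter_level x * p (letter_index x)).

Definition root_lattice := {malg int[I]}.
Definition simple_root (i : I) : root_lattice := basis i.

Definition root_form : root_lattice -> root_lattice -> int :=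
  linext2 (V := int^o) (fun i j => (d i)%:Z * D i j).

Definition Qq := {fraction {poly rat}}.
Definition q : Qq := tofrac 'X.
Definition qi (i : I) : Qq := q ^+ d i.

Definition word := {fmonom letter}.

Definition word_weight (w : word) : root_lattice :=
  \sum_(x <- (w : seq letter)) simple_root (letter_index x) *+ letter_level x.
Definition word_parity (w : word) : bool :=
  odd (\sum_(x <- (w : seq letter)) letter_parity x).

(* The algebra F, with basis the words in the generators. *)
Definition free_alg := {malg Qq[word]}.
HB.instance Definition _ := GRing.Lalgebra.on free_alg.
HB.instance Definition _ := GRing.Lalgebra_isAlgebra.Build Qq free_alg
  (@malg_scaleAr _ _).

Definition free_alg_ind : forall P : free_alg -> Prop,
    P 0 -> (forall c x y, P x -> P y -> P (c *: x + y)) ->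
  (forall w, P (basis w)) -> forall x, P x := @malg_lin_ind _ _.

Definition letter_gen (x : letter) : free_alg := basis (fmu x).

(* a_il, with the junk value 0 when (i, l) is not in I^infty. *)
Definition gen (i : I) (l : nat) : free_alg :=
  oapp letter_gen 0 (insub (i, l)).

(* F (x) F, as the free module on pairs of words: basis (u, v) is u (x) v. *)
Definition tensor := {malg Qq[(word * word)%type]}.
HB.instance Definition _ := GRing.Lmodule.on tensor.

Definition tensor_ind : forall P : tensor -> Prop,
    P 0 -> (forall c x y, P x -> P y -> P (c *: x + y)) ->
  (forall a, P (basis a)) -> forall x, P x := @malg_lin_ind _ _.

Definition tens : free_alg -> free_alg -> tensor :=
  linext2 (fun u v => basis (u, v) : tensor).

Definition twist (v u : word) : Qq :=
  (-1) ^+ (word_parity v * word_parity u)%N *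
  q ^ root_form (word_weight v) (word_weight u).

Definition tensor_mul : tensor -> tensor -> tensor :=
  linext2 (fun a b : word * word =>
    twist a.2 b.1 *: basis (mmul a.1 b.1, mmul a.2 b.2) : tensor).

Definition tensor_one : tensor := basis (mone, mone).

Lemma q_neq0 : q != 0.
Proof. by rewrite tofrac_eq0 polyX_eq0. Qed.

Lemma word_weightM : {morph word_weight : u v / mmul u v >-> u + v}.
Proof. by move=> u v; rewrite /word_weight fmM big_cat. Qed.

Lemma word_parityM u v :
  word_parity (mmul u v) = word_parity u (+) word_parity v.
Proof. by rewrite /word_parity fmM big_cat oddD. Qed.

Lemma twistMl u v w : twist (mmul u v) w = twist u w * twist v w.
Proof.
rewrite /twist word_weightM word_parityM [root_form _ _]linearDl.
rewrite expfzDr ?q_neq0 // mulrACA; congr (_ * _).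
by case: (word_parity u) (word_parity v) (word_parity w) => [] [] [];
  rewrite /= ?expr0 ?expr1 ?mulN1r ?mul1r ?opprK.
Qed.

Lemma twistMr u v w : twist w (mmul u v) = twist w u * twist w v.
Proof.
rewrite /twist word_weightM word_parityM [root_form _ _]linearDr.
rewrite expfzDr ?q_neq0 // mulrACA; congr (_ * _).
by case: (word_parity u) (word_parity v) (word_parity w) => [] [] [];
  rewrite /= ?expr0 ?expr1 ?mulN1r ?mul1r ?opprK.
Qed.

Lemma twist1l w : twist mone w = 1.
Proof.
rewrite /twist /word_weight /word_parity fm1 !big_nil mul0n expr0.
by rewrite [root_form _ _]linear0l expr0z mulr1.
Qed.

Lemma twist1r w : twist w mone = 1.
Proof.
rewrite /twist /word_weight /word_parity fm1 !big_nil muln0 expr0.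
by rewrite [root_form _ _]linear0r expr0z mulr1.
Qed.

Lemma tensor_mulU a b : tensor_mul (basis a) (basis b) =
  twist a.2 b.1 *: basis (mmul a.1 b.1, mmul a.2 b.2).
Proof. exact: linext2U. Qed.

Lemma tensor_mulPl c x y z :
  tensor_mul (c *: x + y) z = c *: tensor_mul x z + tensor_mul y z.
Proof. exact: (linext2_is_bilinear _).1. Qed.

Lemma tensor_mulPr c x y z :
  tensor_mul z (c *: x + y) = c *: tensor_mul z x + tensor_mul z y.
Proof. exact: (linext2_is_bilinear _).2. Qed.

Lemma tensor_mul0l x : tensor_mul 0 x = 0.
Proof. exact: linear0l. Qed.

Lemma tensor_mul0r x : tensor_mul x 0 = 0.
Proof. exact: linear0r. Qed.

Lemma tensor_mulZl c x y : tensor_mul (c *: x) y = c *: tensor_mul x y.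
Proof. by rewrite -[c *: x]addr0 tensor_mulPl tensor_mul0l addr0. Qed.

Lemma tensor_mulZr c x y : tensor_mul x (c *: y) = c *: tensor_mul x y.
Proof. by rewrite -[c *: y]addr0 tensor_mulPr tensor_mul0r addr0. Qed.

Lemma tensor_mulDl : left_distributive tensor_mul +%R.
Proof. by move=> x y z; have := tensor_mulPl 1 x y z; rewrite !scale1r. Qed.

Lemma tensor_mulDr : right_distributive tensor_mul +%R.
Proof. by move=> x y z; have := tensor_mulPr 1 y z x; rewrite !scale1r. Qed.

Lemma tensor_mulA : associative tensor_mul.
Proof.
elim/tensor_ind=> [|c x x' Hx Hx'|a] y z; first by rewrite !tensor_mul0l.
  by rewrite !tensor_mulPl Hx Hx'.
elim/tensor_ind: y z => [|c x x' Hx Hx'|b] z.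
- by rewrite tensor_mul0l !tensor_mul0r tensor_mul0l.
- move: (basis a) Hx Hx' => u Hx Hx'.
  by rewrite tensor_mulPl !tensor_mulPr tensor_mulPl Hx Hx'.
elim/tensor_ind: z => [|c x x' Hx Hx'|e].
- by move: (basis a) (basis b) => u v; rewrite !tensor_mul0r.
- move: (basis a) (basis b) Hx Hx' => u v Hx Hx'.
  by rewrite !tensor_mulPr Hx Hx'.
rewrite (tensor_mulU a b) (tensor_mulU b e).
rewrite [LHS]tensor_mulZr [RHS]tensor_mulZl !tensor_mulU /= !scalerA.
rewrite !(mulmA, twistMl, twistMr).
move: (twist a.2 b.1) (twist b.2 e.1) (twist a.2 e.1) => s t r.
by rewrite [t * _]mulrC mulrA.
Qed.

Lemma tensor_mul1l : left_id tensor_one tensor_mul.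
Proof.
elim/tensor_ind=> [|c x y Hx Hy|[a b]]; first exact: tensor_mul0r.
  by rewrite tensor_mulPr Hx Hy.
by rewrite tensor_mulU /= twist1l scale1r !mul1m.
Qed.

Lemma tensor_mul1r : right_id tensor_one tensor_mul.
Proof.
elim/tensor_ind=> [|c x y Hx Hy|[a b]]; first exact: tensor_mul0l.
  by rewrite tensor_mulPl Hx Hy.
by rewrite tensor_mulU /= twist1r scale1r !mulm1.
Qed.

Lemma tensor_one_neq0 : tensor_one != 0.
Proof.
rewrite /tensor_one basis.unlock.
by apply/eqP=> /malgP/(_ (mone, mone))/eqP; rewrite mcoeffUU mcoeff0 oner_eq0.
Qed.

HB.instance Definition _ := GRing.Zmodule_isNzRing.Build tensor
  tensor_mulA tensor_mul1l tensor_mul1r tensor_mulDl tensor_mulDr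
  tensor_one_neq0.

HB.instance Definition _ := GRing.Lmodule_isLalgebra.Build Qq tensor
  (fun c x y => esym (tensor_mulZl c x y)).

HB.instance Definition _ := GRing.Lalgebra_isAlgebra.Build Qq tensor
  (fun c x y => esym (tensor_mulZr c x y)).

(* The algebra morphism is determined by its values on the free generators:
   a word is sent to the product of the images of its letters. *)
Definition rho_word (w : word) : tensor :=
  \prod_(x <- (w : seq letter))
    (tens (letter_gen x) 1 + tens 1 (letter_gen x)).

Definition rho : free_alg -> tensor := linext rho_word.
HB.instance Definition _ := GRing.Linear.on rho.

Lemma basis1 : basis mone = 1 :> free_alg.
Proof. by rewrite basis.unlock. Qed.

Lemma basisM (u v : word) : basis (mmul u v) = basis u * basis v :> free_alg.
Proof. by rewrite basis.unlock malgM_def fgmulUU mulr1. Qed.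

Lemma rhoP c x y : rho (c *: x + y) = c *: rho x + rho y.
Proof. exact: linearP. Qed.

Lemma rho_gen x :
  rho (letter_gen x) = tens (letter_gen x) 1 + tens 1 (letter_gen x).
Proof. by rewrite /rho linextU /rho_word fmU big_seq1. Qed.



Lemma rho_is_monoid_morphism : monoid_morphism rho.
Proof.
split=> [|x y]; first by rewrite -basis1 /rho linextU /rho_word fm1 big_nil.
elim/free_alg_ind: x => [|c x x' Hx Hx'|u].
- by rewrite mul0r linear0 mul0r.
- have E : (c *: x + x') * y = c *: (x * y) + x' * y.
    by rewrite mulrDl scalerAl.
  apply: etrans (congr1 rho E) _; apply: etrans (rhoP _ _ _) _.
  apply: etrans (congr2 (fun s t => c *: s + t) Hx Hx') _.
  apply: etrans _ (congr1 (fun t => t * rho y) (esym (rhoP c x x'))).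
  by rewrite mulrDl scalerAl.
elim/free_alg_ind: y => [|c y y' Hy Hy'|v].
- by rewrite mulr0 linear0 mulr0.
- move: (basis u : free_alg) Hy Hy' => x Hy Hy'.
  have E : x * (c *: y + y') = c *: (x * y) + x * y'.
    by rewrite mulrDr scalerAr.
  apply: etrans (congr1 rho E) _; apply: etrans (rhoP _ _ _) _.
  apply: etrans (congr2 (fun s t => c *: s + t) Hy Hy') _.
  apply: etrans _ (congr1 (fun t => rho x * t) (esym (rhoP c y y'))).
  by rewrite mulrDr scalerAr.
by rewrite -basisM /rho !linextU /rho_word fmM big_cat.
Qed.

HB.instance Definition _ := GRing.isMonoidMorphism.Build free_alg tensor rho
  rho_is_monoid_morphism.

(* The form (x1 (x) x2, x3 (x) x4) = (x1, x3)(x2, x4) on F (x) F. *)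
Definition tensor_form (B : free_alg -> free_alg -> Qq)
    : tensor -> tensor -> Qq :=
  linext2 (V := Qq^o) (fun a b : word * word =>
    B (basis a.1) (basis b.1) * B (basis a.2) (basis b.2)).

Record bialgebra_form := BialgebraForm {
  form :> {biscalar free_alg};
  form1 : form 1 1 = 1;
  form_gen : forall x y : letter,
    form (letter_gen x) (letter_gen y) =
      if x == y
      then (1 - (-1) ^+ letter_parity x * qi (letter_index x) ^+ (2 * letter_level x))^-1
      else 0;
  formMr : forall x y y' : free_alg,
    form x (y * y') = tensor_form form (rho x) (tens y y');
  formMl : forall x x' y : free_alg,
    form (x * x') y = tensor_form form (tens x x') (rho y)
}.

Section Quotient.
Variable B : bialgebra_form.

Lemma tensE u v : tens (basis u) (basis v) = basis (u, v).
Proof. exact: linext2U. Qed.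

Lemma tensor_formPl F c s s' t : tensor_form F (c *: s + s') t =
  c * tensor_form F s t + tensor_form F s' t.
Proof. exact: ((linext2_is_bilinear (V := Qq^o) _).1 t c s s'). Qed.

Lemma tensor_formPr F c s t t' : tensor_form F s (c *: t + t') =
  c * tensor_form F s t + tensor_form F s t'.
Proof. exact: ((linext2_is_bilinear (V := Qq^o) _).2 s c t t'). Qed.

Lemma tensor_form0l F t : tensor_form F 0 t = 0.
Proof.
by have := tensor_formPl F (-1) 0 0 t; rewrite scaler0 addr0 mulN1r addNr.
Qed.

Lemma tensor_form0r F s : tensor_form F s 0 = 0.
Proof.
by have := tensor_formPr F (-1) s 0 0; rewrite scaler0 addr0 mulN1r addNr.
Qed.

Lemma tensPl c x x' y : tens (c *: x + x') y = c *: tens x y + tens x' y.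
Proof. exact: (linext2_is_bilinear _).1. Qed.

Lemma tensPr c x y y' : tens x (c *: y + y') = c *: tens x y + tens x y'.
Proof. exact: (linext2_is_bilinear _).2. Qed.

Lemma tens0l y : tens 0 y = 0.
Proof. exact: linear0l. Qed.

Lemma tens0r y : tens y 0 = 0.
Proof. exact: linear0r. Qed.

Lemma formPl c x x' y : B (c *: x + x') y = c * B x y + B x' y.
Proof. exact: linearPl. Qed.

Lemma formPr c x y y' : B x (c *: y + y') = c * B x y + B x y'.
Proof. exact: linearPr. Qed.

Lemma form0l y : B 0 y = 0.
Proof. exact: linear0l. Qed.

Lemma form0r y : B y 0 = 0.
Proof. exact: linear0r. Qed.

Lemma tensor_form_tensl x y u v :
  tensor_form B (tens x y) (basis (u, v)) = B x (basis u) * B y (basis v).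
Proof.
elim/free_alg_ind: x => [|c x x' Hx Hx'|w].
- by rewrite tens0l tensor_form0l form0l mul0r.
- by rewrite tensPl tensor_formPl formPl Hx Hx' mulrDl mulrA.
elim/free_alg_ind: y => [|c x x' Hx Hx'|w'].
- by rewrite tens0r tensor_form0l form0l mulr0.
- by rewrite tensPr tensor_formPl formPl Hx Hx' mulrDr mulrCA.
by rewrite tensE /tensor_form linext2U.
Qed.

Definition form_radical : {pred free_alg} :=
  fun x => boolp.asbool (forall y, B x y = 0).

Lemma form_radicalP x : reflect (forall y, B x y = 0) (x \in form_radical).
Proof. exact: boolp.asboolP. Qed.

Lemma form_radical_zmod : zmod_closed form_radical.
Proof.
split=> [|x y /form_radicalP Hx /form_radicalP Hy].
  by apply/form_radicalP=> y; rewrite form0l.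
by apply/form_radicalP=> z; rewrite addrC -scaleN1r formPl Hx Hy mulr0 addr0.
Qed.

HB.instance Definition _ := GRing.isZmodClosed.Build free_alg form_radical
  form_radical_zmod.

Lemma form_radicalMr x y : x \in form_radical -> x * y \in form_radical.
Proof.
move=> /form_radicalP Hx; apply/form_radicalP=> z; rewrite formMl.
elim/tensor_ind: (rho z) => [|c t t' Ht Ht'|[u v]].
- exact: tensor_form0r.
- by rewrite tensor_formPr Ht Ht' mulr0 addr0.
- by rewrite tensor_form_tensl Hx mul0r.
Qed.

Lemma form_radicalMl x y : x \in form_radical -> y * x \in form_radical.
Proof.
move=> /form_radicalP Hx; apply/form_radicalP=> z; rewrite formMl.
elim/tensor_ind: (rho z) => [|c t t' Ht Ht'|[u v]].
- exact: tensor_form0r.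
- by rewrite tensor_formPr Ht Ht' mulr0 addr0.
- by rewrite tensor_form_tensl Hx mulr0.
Qed.

Lemma form_radical1 : 1 \notin form_radical.
Proof.
apply/form_radicalP=> /(_ 1)/eqP; by rewrite form1 oner_eq0.
Qed.

Definition Uplus := Quotient.quot form_radical.
HB.instance Definition _ := GRing.Zmodule.on Uplus.
HB.instance Definition _ := GRing.Zmodule_isNzRing.Build Uplus
  (quot_mulA form_radicalMl form_radicalMr)
  (quot_mul1l form_radicalMl form_radicalMr)
  (quot_mul1r form_radicalMl form_radicalMr)
  (quot_mulDl form_radicalMl form_radicalMr)
  (quot_mulDr form_radicalMl form_radicalMr)
  (quot_one_neq0 form_radical1).
HB.instance Definition _ := GRing.Zmodule_isLmodule.Build Qq Uplus
  (quot_scaleA form_radicalMl) (quot_scale1 form_radicalMl)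
  (quot_scaleDr form_radicalMl) (quot_scaleDl form_radicalMl).
HB.instance Definition _ := GRing.Lmodule_isLalgebra.Build Qq Uplus
  (quot_scaleAl form_radicalMl form_radicalMr).
HB.instance Definition _ := GRing.Lalgebra_isAlgebra.Build Qq Uplus
  (quot_scaleAr form_radicalMl form_radicalMr).

Definition toUplus (x : free_alg) : Uplus := \pi_Uplus x.

HB.instance Definition _ := GRing.isLinear.Build Qq free_alg Uplus *:%R toUplus
  (fun c x y => etrans (quot_piD form_radical (c *: x) y)
    (congr1 (fun t => t + toUplus y) (quot_piZ form_radicalMl c x))).
HB.instance Definition _ := GRing.isMonoidMorphism.Build free_alg Uplus toUplus
  (conj erefl (quot_piM form_radicalMl form_radicalMr)).

End Quotient.

Definition pm_qi (i : I) : Qq := (-1) ^+ p i * qi i.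

Definition qint (i : I) (s : nat) : Qq :=
  (pm_qi i ^+ s - qi i ^- s) / (pm_qi i - (qi i)^-1).

Definition qfact (i : I) (n : nat) : Qq := \prod_(1 <= s < n.+1) qint i s.

Definition divided_power (i : I) (n : nat) : free_alg :=
  (qfact i n)^-1 *: gen i 1 ^+ n.

(* a_{j,c}; the tuple c is only used for imaginary j. *)
Definition middle_factor (j : I) (n : nat) (c : seq nat) : free_alg :=
  if real_index j then divided_power j n else \prod_(l <- c) gen j l.

Definition serre_element (i j : I) (m n : nat) (c : seq nat) : free_alg :=
  \sum_(r < m.+1)
    ((-1) ^+ r * (-1) ^+ (n * r * p i * p j + 'C(r, 2) * p i)%N *
     pm_qi i ^ (- (r%:Z * (n%:Z * D i j + m%:Z - 1)))) *:
    (divided_power i r * middle_factor j n c * divided_power i (m - r)).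

End BorcherdsSuperalgebra.

(* Main.v *)
From HB Require Import structures.
Require Import Defs.
From mathcomp Require Import all_boot all_order all_algebra.
From mathcomp.multinomials Require Import monalg.
From mathcomp Require Import ring zify.
Set Implicit Arguments.
Unset Strict Implicit.
Unset Printing Implicit Defensive.
Import Order.TTheory GRing.Theory Num.Theory.
Local Open Scope ring_scope.

(** The radical is detected by skew derivations. For a generator a_k,
    contracting the left tensor factor of the coproduct of y against a_k defines
    a linear map d_k with (y, a_k z) = (d_k y, z) (skew_der_dual) and the twisted
    Leibniz rule (skew_der_letterM)
      d_k (a_x y) = (a_x, a_k) y + t(x, k) a_x d_k(y),
    where t(x, k) is the sign and power of q by which the product of F (x) F
    twists. Since (y, 1) only sees the constant term of y, an element is in the
    radical as soon as all its iterated derivatives have constant term 0.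

    Fix the real index i and write S(m, n, y) for the Serre sum
      sum over r + s = m of c_(m,n)(r) a_i^(r) y a_i^(s),
    where y is any combination of products of generators a_jl of total level n.
    The coefficients are made so that these sums are stable under all
    derivations. With Q = q_i, N = n a_ij + m and pi = (-1)^p(i), one has
      d_i S(m+1, n, y) = const (Q^N - pi^m Q^(-N)) S(m, n, y),
      d_jl S(m, l+n, y) = S(m, n, d_jl y),
    and all other derivations kill S; these are skew_der_serre_sum_real,
    skew_der_serre_sum_neq and skew_der_serre_sum_const. The second kind of step
    preserves m > - n a_ij because a_ij <= 0. The first kind preserves it unless
    N = 0, and then the scalar Q^N - pi^m Q^(-N) is zero, because m = - n a_ij
    is even when i is odd. So any sequence of derivations takes S(m, n, y) to a
    multiple of another Serre sum with m > 0, whose constant term is 0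
    (form_serre_sum). Letting y vary over the whole span of words in the a_jl is
    what makes the induction close: it treats real and imaginary j, and all
    tuples c, at once. *)

(** * Scalar identities *)

(** The quantum integer of the statement is the Gaussian integer
    1 + v + ... + v^n in v = P Q^2, recentred by the power Q^n. *)
Lemma geometric_sum_qint (K : fieldType) (P Q : K) (n : nat) :
    Q != 0 -> P * Q ^+ 2 != 1 ->
  \sum_(t < n.+1) (P * Q ^+ 2) ^+ t =
  Q ^+ n * (((P * Q) ^+ n.+1 - Q ^- n.+1) / (P * Q - Q^-1)).
Proof.
move=> Q0; rewrite -subr_eq0 => v1.
have Ev : P * Q ^+ 2 - 1 = Q * (P * Q - Q^-1).
  by rewrite mulrBr divff // mulrCA.
have pm0 : P * Q - Q^-1 != 0.
  by apply: contraNneq v1; rewrite Ev => ->; rewrite mulr0.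
apply: (mulfI v1); rewrite -subrX1 {v1}Ev mulrACA.
rewrite (mulrC (P * Q - Q^-1)) divfK //.
rewrite -exprS mulrBr mulfV ?expf_neq0 //; congr (_ - _).
by rewrite -exprMn mulrCA.
Qed.

Lemma mulf_div_cancelr (K : fieldType) (f x b y : K) : x != 0 ->
  (f * x)^-1 * (b * (y * x)) = b * y / f.
Proof.
by move=> x0; rewrite [b * _]mulrA mulrC invfM [f^-1 * _]mulrC mulrA mulfK.
Qed.

Section SerreCoefficients.
Context (K : fieldType) (Q : K) (a : int) (b c : bool).
Hypotheses (Q_neq0 : Q != 0) (a_even : b -> (2 %| a)%Z).

Definition serre_coef (m n r : nat) : K :=
  (-1) ^+ r * (-1) ^+ (n * r * b * c + 'C(r, 2) * b)%N *
  ((-1) ^+ b * Q) ^ (- (r%:Z * (n%:Z * a + m%:Z - 1))).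

(** When b holds, a is even, so the sign (-1)^b raised to the integer
    - r (n a + m - 1) depends only on the parity of r (m + 1). This turns the
    coefficient into natural powers of signs times one integer power of Q. *)
Lemma serre_coefE m n r : serre_coef m n r =
  (-1) ^+ r * ((-1) ^+ (b * c)%N) ^+ (n * r) *
  ((-1) ^+ b) ^+ ('C(r, 2) + r * m.+1) * Q ^ (- (r%:Z * (n%:Z * a + m%:Z - 1))).
Proof.
rewrite /serre_coef expfzMl.
suff -> : ((-1 : K) ^+ b) ^ (- (r%:Z * (n%:Z * a + m%:Z - 1))) =
    ((-1) ^+ b) ^+ (r * m.+1).
  have -> : (n * r * b * c)%N = (b * c * (n * r))%N by rewrite -mulnA mulnC.
  by rewrite [('C(_, _) * _)%N]mulnC !exprD !exprM !mulrA.
case: b a_even => [/(_ isT)/dvdzP[a' ->]|_]; last first.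
  by rewrite expr0 exp1rz expr1n.
rewrite expr1; have -> : - (r%:Z * (n%:Z * (a' * 2) + m%:Z - 1)) =
   2 * (- (r%:Z * n%:Z * a') - r%:Z * m%:Z) + (r * m.+1)%N%:Z.
  by rewrite PoszM intS; ring.
rewrite expfzDr ?oppr_eq0 ?oner_eq0 //.
have sqrN1 : (-1 : K) ^ (2 : int) = 1 by exact: etrans (sqrrN 1) (expr1n _ 2).
by rewrite -exprz_exp sqrN1 exp1rz mul1r.
Qed.

(** The two ways in which the term with index r of a Serre sum of order m
    arises when d_i is applied to one of order m + 1 (removing a letter a_i on
    the left or on the right of y) add up to a multiple of the coefficient of
    order m, by a factor independent of r. *)
Lemma serre_coef_lower m n r : (r <= m)%N ->
  serre_coef m.+1 n r.+1 * Q ^+ r +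
  serre_coef m.+1 n r * (((-1) ^+ b * Q ^+ 2) ^+ r *
    ((-1) ^+ (b * c)%N * Q ^ a) ^+ n * Q ^+ (m - r)) =
  ((-1) ^+ (b * c)%N) ^+ n *
    (Q ^ (n%:Z * a + m%:Z) - ((-1) ^+ b) ^+ m * Q ^ (- (n%:Z * a + m%:Z))) *
  serre_coef m n r.
Proof.
move=> le_rm; rewrite !serre_coefE (exprMn n) (exprnP (Q ^ a)) exprz_exp.
rewrite [a * _]mulrC.
set X := Q ^ (n%:Z * a + m%:Z); set Z := Q ^ (- (r%:Z * (n%:Z * a + m%:Z))).
have -> : Q ^ (- (n%:Z * a + m%:Z)) = X^-1 by rewrite invr_expz.
have -> : Q ^ (- (r%:Z * (n%:Z * a + m.+1%:Z - 1))) = Z.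
  by congr (Q ^ _); rewrite intS; ring.
have -> : Q ^ (- (r.+1%:Z * (n%:Z * a + m.+1%:Z - 1))) = Z * X^-1.
  rewrite invr_expz -expfzDr //; congr (Q ^ _).
  by rewrite !intS; ring.
have -> : Q ^ (- (r%:Z * (n%:Z * a + m%:Z - 1))) = Z * Q ^+ r.
  by rewrite exprnP -expfzDr //; congr (Q ^ _); ring.
have EX : X = Q ^ (n%:Z * a) * Q ^+ (m - r) * Q ^+ r.
  by rewrite -mulrA -exprD subnK // exprnP -expfzDr.
move: X^-1 => X'; rewrite {}EX.
have Pr s : ((-1 : K) ^+ b) ^+ s * ((-1) ^+ b) ^+ s = 1.
  by rewrite -!exprMn mulrNN mulr1 !expr1n.
move: ((-1) ^+ b) ((-1) ^+ (b * c)%N) Pr => P e Pr.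
have -> : 'C(r.+1, 2) = ('C(r, 2) + r)%N by rewrite binS bin1.
have -> : (r.+1 * m.+2)%N = (r * m + r + r + m + 2)%N.
  by rewrite mulSn !mulnS; lia.
have -> : (r * m.+2)%N = (r * m + r + r)%N by rewrite !mulnS; lia.
rewrite !mulnS !exprD exprMn [Q ^+ 2 ^+ r]exprAC exprS.
have -> : P ^+ (r * m) * P ^+ r * P ^+ r = P ^+ (r * m).
  by rewrite -mulrA Pr mulr1.
have -> : P ^+ 2 = 1 by exact: Pr 1%N.
by ring.
Qed.

(** Removing a letter of level l from y costs the twist of a_i^r past it, which
    is exactly the change of the coefficient from n + l to n. *)
Lemma serre_coef_level m n l r :
  serre_coef m (l + n) r * (((-1) ^+ (b * c)%N * Q ^ a) ^+ l) ^+ r =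
  serre_coef m n r.
Proof.
rewrite !serre_coefE (exprMn l) (exprnP (Q ^ a)) exprz_exp [a * _]mulrC.
have -> : Q ^ (- (r%:Z * (n%:Z * a + m%:Z - 1))) =
    Q ^ (- (r%:Z * ((l + n)%N%:Z * a + m%:Z - 1))) * (Q ^ (l%:Z * a)) ^+ r.
  rewrite (exprnP (Q ^ _)) exprz_exp -expfzDr //; congr (Q ^ _).
  by rewrite PoszD; ring.
have sq1 :
    ((-1 : K) ^+ (b * c)%N) ^+ (l * r) * ((-1) ^+ (b * c)%N) ^+ (l * r) = 1.
  by rewrite -!exprMn mulrNN mulr1 !expr1n.
rewrite mulnDl exprD exprMn -(exprM _ l).
by rewrite -[RHS]mul1r -[X in _ = X * _]sq1; ring.
Qed.
End SerreCoefficients.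

(** * Twisted derivations *)

(** An algebra generated by elements g x, with one twisted derivation d k for
    each of them. This is all that the calculus of Serre sums uses of F, and it
    makes no reference to the form. *)
Section TwistedDerivations.
Context (K : fieldType) (A : algType K) (X I : eqType) (g : X -> A).
Context (index : X -> I) (level : X -> nat).
Context (d : X -> {linear A -> A}) (pair braid : X -> X -> K).
Hypothesis gen_ind : forall P : A -> Prop,
  P 0 -> (forall c y z, P y -> P z -> P (c *: y + z)) ->
  P 1 -> (forall x y, P y -> P (g x * y)) -> forall y, P y.
Hypothesis pair_neq : forall x k, x != k -> pair x k = 0.
Hypothesis der1 : forall k, d k 1 = 0.
Hypothesis der_genM : forall k x y,
  d k (g x * y) = pair x k *: y + braid x k *: (g x * d k y).
Implicit Types (x k : X) (y z : A) (e : K).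

Definition twisted_leibniz k e y :=
  forall z, d k (y * z) = d k y * z + e *: (y * d k z).

Lemma der_gen k x : d k (g x) = (pair x k)%:A.
Proof. by have := der_genM k x 1; rewrite mulr1 der1 mulr0 scaler0 addr0. Qed.

Lemma twisted_leibniz_gen k x : twisted_leibniz k (braid x k) (g x).
Proof. by move=> z; rewrite der_genM der_gen -scalerAl mul1r. Qed.

Lemma twisted_leibniz1 k : twisted_leibniz k 1 1.
Proof. by move=> z; rewrite der1 !mul1r scale1r mul0r add0r. Qed.

Lemma twisted_leibnizM k e e' y y' : twisted_leibniz k e y ->
  twisted_leibniz k e' y' -> twisted_leibniz k (e * e') (y * y').
Proof.
move=> Hy Hy' z; rewrite -mulrA !Hy Hy' mulrDr mulrDl scalerDr !mulrA.
by rewrite -!scalerAr -scalerAl scalerA addrA !mulrA.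
Qed.

Lemma twisted_leibnizP k e c y y' : twisted_leibniz k e y ->
  twisted_leibniz k e y' -> twisted_leibniz k e (c *: y + y').
Proof.
move=> Hy Hy' z; rewrite mulrDl -scalerAl !linearP /= Hy Hy' !mulrDl.
by rewrite -!scalerAl !scalerDr !scalerA addrACA [e * c]mulrC.
Qed.

Lemma twisted_leibniz0 k e : twisted_leibniz k e 0.
Proof. by move=> z; rewrite mul0r linear0 !mul0r scaler0 addr0. Qed.

Lemma twisted_leibnizZ k e c y :
  twisted_leibniz k e y -> twisted_leibniz k e (c *: y).
Proof.
move=> Hy; rewrite -[c *: y]addr0; apply: twisted_leibnizP => //.
exact: twisted_leibniz0.
Qed.

Lemma twisted_leibnizX k e y n :
  twisted_leibniz k e y -> twisted_leibniz k (e ^+ n) (y ^+ n).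
Proof.
move=> Hy; elim: n => [|n IHn]; first exact: twisted_leibniz1.
by rewrite !exprS; apply: twisted_leibnizM.
Qed.

(** On powers of one generator the twisted derivation acts like a
    q-derivative. *)
Lemma der_genX k n :
  d k (g k ^+ n) = (pair k k * \sum_(t < n) braid k k ^+ t) *: g k ^+ n.-1.
Proof.
elim: n => [|n IHn]; first by rewrite expr0 der1 big_ord0 mulr0 scale0r.
rewrite exprS der_genM IHn big_ord_recl expr0 mulrDr mulr1 scalerDl /=.
congr (_ + _); rewrite -scalerAr scalerA mulrCA big_distrr /=.
case: n {IHn} => [|n]; first by rewrite !big_ord0 !mulr0 !scale0r.
rewrite -exprS; congr ((_ * _) *: _).
by apply: eq_bigr => t _; rewrite exprS.
Qed.

(** The twist of y only ever multiplies the derivative of z, so it disappears for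
    all y, even for those that are not homogeneous. *)
Lemma derM_const k y z : d k z = 0 -> d k (y * z) = d k y * z.
Proof.
move=> dz0; elim/gen_ind: y => [|c y y' Hy Hy'||x y Hy].
- by rewrite mul0r linear0 mul0r.
- by rewrite mulrDl -scalerAl !linearP /= Hy Hy' mulrDl -scalerAl.
- by rewrite mul1r dz0 der1 mul0r.
by rewrite -mulrA !der_genM Hy mulrDl -!scalerAl -mulrA.
Qed.

(** The weight space of weight n alpha_j, given by closure rules rather than by
    its basis of words, so that facts about it are proved one letter at a
    time. *)
Inductive level_span (j : I) : nat -> A -> Prop :=
| level_span0 n : level_span j n 0
| level_spanP n c y z :
    level_span j n y -> level_span j n z -> level_span j n (c *: y + z)
| level_span1 : level_span j 0 1
| level_spanM x n y : index x = j -> level_span j n y ->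
    level_span j (level x + n) (g x * y).

Lemma level_spanZ j n c y : level_span j n y -> level_span j n (c *: y).
Proof. by move=> Hy; rewrite -[c *: y]addr0; apply/level_spanP/level_span0. Qed.

Lemma der_level_span j n y k : level_span j n y ->
  d k y = 0 \/ index k = j /\
  exists2 n', n = (level k + n')%N & level_span j n' (d k y).
Proof.
elim=> [{}n|{}n c {}y z Hy IHy Hz IHz||x {}n {}y xj Hy IHy].
- by left; apply: linear0.
- rewrite linearP /=.
  case: IHy => [->|[kj [n' En ky]]]; first by rewrite scaler0 add0r.
  right; split=> //; exists n' => //; apply: level_spanP => //.
  case: IHz => [->|[_ [n'' En2]]]; first exact: level_span0.
  by have /eqP := En; rewrite En2 eqn_add2l => /eqP ->.
- by left; apply: der1.
rewrite der_genM; have [xk|xk] := eqVneq x k; last first.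
  rewrite pair_neq // scale0r add0r; case: IHy => [->|[kj [n' -> ky]]].
    by left; rewrite mulr0 scaler0.
  right; split=> //; exists (level x + n')%N; first by rewrite addnCA.
  exact/level_spanZ/level_spanM.
rewrite -{k}xk in IHy *; right; split=> //; exists n => //.
apply: level_spanP => //.
case: IHy => [->|[_ [n' -> ky]]].
  by rewrite mulr0 scaler0; apply: level_span0.
exact/level_spanZ/level_spanM.
Qed.

(** The twist past d k depends on an element only through its weight. *)
Lemma twisted_leibniz_level_span k j e n y :
    (forall x, index x = j -> braid x k = e ^+ level x) ->
  level_span j n y -> twisted_leibniz k (e ^+ n) y.
Proof.
move=> twist_j; elim=> [{}n|{}n c {}y z _ Hy _ Hz||x {}n {}y xj _ Hy].
- exact: twisted_leibniz0.
- exact: twisted_leibnizP.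
- exact: twisted_leibniz1.
by rewrite exprD -twist_j //; apply/twisted_leibnizM/Hy/twisted_leibniz_gen.
Qed.

Section SandwichSums.
Context (p : nat -> A).

Definition sandwich_sum (c : nat -> K) m y : A :=
  \sum_(r < m.+1) c r *: (p r * y * p (m - r)).

Lemma eq_sandwich_sum c c' m y :
  (forall r, (r <= m)%N -> c r = c' r) ->
  sandwich_sum c m y = sandwich_sum c' m y.
Proof. by move=> cc'; apply: eq_bigr => r _; rewrite cc' // -ltnS. Qed.

Lemma sandwich_sumZ c e m y :
  sandwich_sum (fun r => e * c r) m y = e *: sandwich_sum c m y.
Proof.
by rewrite /sandwich_sum scaler_sumr; apply: eq_bigr => r _; rewrite scalerA.
Qed.

(** This is how the derivations d_jl act on a Serre sum: they kill the a_i^(r),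
    and passing a_i^(r) contributes the r-th power of a fixed twist. *)
Lemma der_sandwich_sum_middle k (e : K) c m y :
    (forall r, d k (p r) = 0) -> (forall r, twisted_leibniz k (e ^+ r) (p r)) ->
  d k (sandwich_sum c m y) = sandwich_sum (fun r => c r * e ^+ r) m (d k y).
Proof.
move=> dp0 Hp; rewrite linear_sum; apply: eq_bigr => r _ /=.
rewrite linearZ /= derM_const // Hp dp0 mul0r add0r.
by rewrite -scalerAl scalerA.
Qed.

(** This is how d_i acts on a Serre sum: it lowers the left or the right index
    by one, and the two resulting sums are aligned by shifting the first. *)
Lemma der_sandwich_sum_outer k (b v e Q : K) c m y :
    d k y = 0 -> twisted_leibniz k e y ->
    d k (p 0) = 0 -> (forall r, d k (p r.+1) = (b * Q ^+ r) *: p r) ->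
    (forall r, twisted_leibniz k (v ^+ r) (p r)) ->
  d k (sandwich_sum c m.+1 y) = b *: sandwich_sum
    (fun r => c r.+1 * Q ^+ r + c r * (v ^+ r * e * Q ^+ (m - r))) m y.
Proof.
move=> dy Hy dp0 dpS Hp; rewrite linear_sum scaler_sumr /=.
(* u and w: the contributions of the left and of the right outer factor *)
pose u r := c r *: (d k (p r) * y * p (m.+1 - r)%N).
pose w r := (c r * (v ^+ r * e)) *: (p r * y * d k (p (m.+1 - r)%N)).
rewrite (eq_bigr (fun r : 'I_m.+2 => u r + w r)) => [|r _]; last first.
  rewrite linearZ /= /u /w (twisted_leibnizM (Hp r) Hy) Hp dy.
  by rewrite mulr0 scaler0 addr0 scalerDr scalerA.
rewrite big_split /= big_ord_recl [X in _ + X]big_ord_recr /=.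
have -> : u 0%N = 0 by rewrite /u dp0 !mul0r scaler0.
have -> : w m.+1 = 0 by rewrite /w subnn dp0 mulr0 scaler0.
rewrite add0r addr0 -big_split /=.
apply: eq_bigr => r _; have le_rm : (r <= m)%N by rewrite -ltnS.
rewrite /u /w /bump /= add1n subSS subSn // !dpS -!scalerAl -scalerAr.
rewrite !scalerA -scalerDl; congr (_ *: _); ring.
Qed.
End SandwichSums.
End TwistedDerivations.

(** * The free algebra and its generators *)

Section FreeAlgebra.
Context (I : countType) (D : borcherds_cartan I).
Implicit Types (x k : letter D) (u : word D).

Lemma word_ind (P : word D -> Prop) : P mone ->
  (forall x w, P w -> P (mmul (fmu x) w)) -> forall w, P w.
Proof.
move=> P1 PM w; rewrite -[w]fmK; elim: (w : seq _) => [|x s IHs].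
  by have /eqP <- : mone == FMonom [::] :> word D by rewrite fmP fm1.
suff /eqP -> : FMonom (x :: s) == mmul (fmu x) (FMonom s) by apply: PM.
by rewrite fmP fmM fmU.
Qed.

Lemma basis_cons x u :
  basis (mmul (fmu x) u) = letter_gen x * basis u :> free_alg D.
Proof. exact: basisM. Qed.

Lemma letter_gen_ind (P : free_alg D -> Prop) :
  P 0 -> (forall c y z, P y -> P z -> P (c *: y + z)) ->
  P 1 -> (forall x y, P y -> P (letter_gen x * y)) -> forall y, P y.
Proof.
move=> P0 PD P1 PM; elim/free_alg_ind=> // u.
elim/word_ind: u => [|x u Pu]; first by rewrite basis1.
by rewrite basis_cons; apply: PM.
Qed.

Lemma gen_letter h l (hl : is_letter D (h, l)) : gen D h l =
  letter_gen (exist _ (h, l) hl).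
Proof. by rewrite /gen (insubT (is_letter D) hl). Qed.

Lemma letter_parityE x :
  (-1) ^+ letter_parity x =
  (-1) ^+ (letter_level x * parity D (letter_index x))%N :> Qq.
Proof. by rewrite /letter_parity signr_odd. Qed.

Lemma root_formMn (s t : root_lattice I) l l' :
  root_form D (s *+ l) (t *+ l') = root_form D s t * l%:Z * l'%:Z.
Proof.
have formDl (s1 s2 t1 : root_lattice I) :
    root_form D (s1 + s2) t1 = root_form D s1 t1 + root_form D s2 t1.
  by rewrite [LHS]linearDl.
have formDr (s1 t1 t2 : root_lattice I) :
    root_form D s1 (t1 + t2) = root_form D s1 t1 + root_form D s1 t2.
  by rewrite [LHS]linearDr.
elim: l => [|l IHl]; first by rewrite mulr0n [LHS]linear0l mulr0 mul0r.
rewrite mulrS formDl {}IHl intS !mulrDr mulr1 mulrDl; congr (_ + _).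
elim: l' => [|l' IHl']; first by rewrite mulr0n [LHS]linear0r mulr0.
by rewrite mulrS formDr IHl' intS mulrDr mulr1.
Qed.

Definition letter_twist x k : Qq := twist (fmu x) (fmu k).

Lemma letter_twistE x k : letter_twist x k =
  (-1) ^+ (letter_parity x * letter_parity k)%N *
  q ^ ((symmetrizer D (letter_index x))%:Z *
       D (letter_index x) (letter_index k) *
       (letter_level x)%:Z * (letter_level k)%:Z).
Proof.
rewrite /letter_twist /twist /word_parity /word_weight !fmU !big_seq1 !oddb.
congr (_ * q ^ _).
by rewrite root_formMn /root_form linext2U.
Qed.
End FreeAlgebra.

(** * Skew derivations of the free algebra *)

Section SkewDerivations.
Context (I : countType) (D : borcherds_cartan I) (B : bialgebra_form D).
Implicit Types (x k : letter D) (u v w : word D).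
Implicit Types (y z : free_alg D) (t : tensor D).

Lemma tensor_form_basis a b :
  tensor_form B (basis a) (basis b) =
  B (basis a.1) (basis b.1) * B (basis a.2) (basis b.2).
Proof. by rewrite /tensor_form linext2U. Qed.

Lemma tensor_basisM (a b : word D * word D) :
  (basis a : tensor D) * basis b =
  twist a.2 b.1 *: basis (mmul a.1 b.1, mmul a.2 b.2).
Proof. exact: tensor_mulU. Qed.

Lemma rho1 : rho (1 : free_alg D) = basis (mone, mone).
Proof. by rewrite -basis1 /rho linextU /rho_word fm1 big_nil. Qed.

Lemma tens1 : tens (1 : free_alg D) 1 = basis (mone, mone).
Proof. by rewrite -basis1 tensE. Qed.

Lemma rho_letter x : rho (letter_gen x) =
  (basis (fmu x, mone) : tensor D) + basis (mone, fmu x).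
Proof. by rewrite rho_gen -basis1 /letter_gen !tensE. Qed.

Lemma rhoM y z : rho (y * z) = rho y * rho z.
Proof. exact: rmorphM. Qed.

Lemma formZl e y z : B (e *: y) z = e * B y z.
Proof. by rewrite -[e *: y]addr0 formPl Defs.form0l addr0. Qed.

Lemma formMr_one y z : B (y * z) 1 = B y 1 * B z 1.
Proof. by rewrite formMl rho1 tensor_form_tensl basis1. Qed.

(** Pairing a generator with 1 = 1 * 1 doubles the value, because a generator is
    primitive for the coproduct; hence the value is 0. *)
Lemma form_letter1 x : B (letter_gen x) 1 = 0.
Proof.
have h : B (letter_gen x) 1 = B (letter_gen x) 1 *+ 2.
  rewrite -{1}[1]mulr1 formMr rho_letter tens1.
  rewrite -[basis (fmu x, mone)]scale1r tensor_formPl !tensor_form_basis /=.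
  by rewrite !basis1 !form1 !mul1r !mulr1.
by move/eqP: h; rewrite mulr2n -subr_eq subrr => /eqP.
Qed.

Lemma form1_letter k : B 1 (letter_gen k) = 0.
Proof.
have h : B 1 (letter_gen k) = B 1 (letter_gen k) *+ 2.
  rewrite -{1}[1]mulr1 formMl rho_letter tens1.
  rewrite -[basis (fmu k, mone)]scale1r tensor_formPr !tensor_form_basis /=.
  by rewrite !basis1 !form1 !mul1r !mulr1.
by move/eqP: h; rewrite mulr2n -subr_eq subrr => /eqP.
Qed.

Lemma form_word1 u : B (basis u) 1 = (u == mone)%:R.
Proof.
elim/word_ind: u => [|x u _]; first by rewrite basis1 form1 eqxx.
rewrite basis_cons formMr_one form_letter1 mul0r.
by rewrite fmM_eq1 fm1_eq1.
Qed.

(** Generators are orthogonal to words of length at least two: this is why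
    contraction against a generator only picks up single letters. *)
Lemma form_word_letter u k :
  B (basis u) (letter_gen k) =
  if u == fmu k then B (letter_gen k) (letter_gen k) else 0.
Proof.
elim/word_ind: u => [|x u _].
  by rewrite basis1 form1_letter eq_sym fm1_eq1.
rewrite basis_cons formMl rho_letter.
rewrite -[basis (fmu k, mone)]scale1r tensor_formPr !tensor_form_tensl.
rewrite !basis1 mul1r form_letter1 mul0r addr0 -/(letter_gen k).
rewrite form_gen form_word1 form_gen eqxx.
have -> : (u == mone) = ((u : seq _) == [::]) by rewrite fmP fm1.
have -> : (mmul (fmu x) u == fmu k) = (x == k) && ((u : seq _) == [::]).
  by rewrite fmP fmM !fmU eqseq_cons.
case: eqP => [<-|_] /=; last by rewrite mul0r.
by case: eqP => _; rewrite ?mulr1 ?mulr0.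
Qed.

(** The map (., z) (x) id from F (x) F to F. *)
Definition contract z : tensor D -> free_alg D :=
  linext (fun a : word D * word D => B (basis a.1) z *: basis a.2).

Lemma contractP z c t t' :
  contract z (c *: t + t') = c *: contract z t + contract z t'.
Proof. exact: linearP. Qed.

Lemma contract0 z : contract z 0 = 0.
Proof. exact: linear0. Qed.

Lemma contractD z t t' : contract z (t + t') = contract z t + contract z t'.
Proof. by have := contractP z 1 t t'; rewrite !scale1r. Qed.

Lemma contractZ z c t : contract z (c *: t) = c *: contract z t.
Proof. by have := contractP z c t 0; rewrite contract0 !addr0. Qed.

Lemma contractU z a : contract z (basis a) = B (basis a.1) z *: basis a.2.
Proof. exact: linextU. Qed.

Lemma form_contract y z t : tensor_form B t (tens y z) = B (contract y t) z.
Proof.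
elim/tensor_ind: t => [|c t t' Ht Ht'|[u v]].
- by rewrite tensor_form0l contract0 Defs.form0l.
- by rewrite tensor_formPl contractP formPl Ht Ht'.
rewrite contractU /= formZl.
elim/free_alg_ind: z => [|c z z' Hz Hz'|w].
- by rewrite tens0r tensor_form0r Defs.form0r mulr0.
- by rewrite tensPr tensor_formPr formPr Hz Hz' mulrDr mulrCA.
elim/free_alg_ind: y => [|c y y' Hy Hy'|w'].
- by rewrite tens0l tensor_form0r Defs.form0r mul0r.
- by rewrite tensPl tensor_formPr formPr Hy Hy' mulrDl mulrA.
by rewrite tensE tensor_form_basis.
Qed.

(** The left factor of the product is a nonempty word, and only the empty word
    pairs with 1. *)
Lemma contract_counitM_l x t :
  contract 1 ((basis (fmu x, mone) : tensor D) * t) = 0.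
Proof.
elim/tensor_ind: t => [|c t t' Ht Ht'|[u v]].
- by rewrite mulr0 contract0.
- by rewrite mulrDr -scalerAr contractP Ht Ht' scaler0 addr0.
rewrite tensor_basisM /= contractZ contractU /= form_word1.
by rewrite fmM_eq1 fm1_eq1 scale0r scaler0.
Qed.

Lemma contract_counitM_r x t :
  contract 1 ((basis (mone, fmu x) : tensor D) * t) = letter_gen x * contract 1 t.
Proof.
elim/tensor_ind: t => [|c t t' Ht Ht'|[u v]].
- by rewrite mulr0 contract0 mulr0.
- by rewrite mulrDr -scalerAr !contractP Ht Ht' mulrDr -scalerAr.
rewrite tensor_basisM /= contractZ !contractU /= mul1m !form_word1.
rewrite basis_cons -scalerAr scalerA; case: eqP => [->|_].
  by rewrite twist1r mul1r.
by rewrite mulr0.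
Qed.

(** Contraction against 1 is the counit on the left tensor factor. *)
Lemma contract_counit y : contract 1 (rho y) = y.
Proof.
elim/free_alg_ind: y => [|c y z Hy Hz|u].
- by rewrite linear0 contract0.
- by rewrite rhoP contractP Hy Hz.
elim/word_ind: u => [|x u IHu].
  by rewrite basis1 rho1 contractU /= basis1 form1 scale1r.
rewrite basis_cons rhoM rho_letter mulrDl contractD contract_counitM_l add0r.
by rewrite contract_counitM_r IHu.
Qed.

Definition skew_der k y := contract (letter_gen k) (rho y).

(** Adjunction: the derivation strips the first letter of the other argument,
    so that membership in the radical is tested by induction on words. *)
Lemma skew_der_dual k y z : B y (letter_gen k * z) = B (skew_der k y) z.
Proof. by rewrite formMr form_contract. Qed.

Lemma skew_derP k c y z :
  skew_der k (c *: y + z) = c *: skew_der k y + skew_der k z.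
Proof. by rewrite /skew_der rhoP contractP. Qed.

Lemma skew_der1 k : skew_der k 1 = 0.
Proof. by rewrite /skew_der rho1 contractU /= basis1 form1_letter scale0r. Qed.

(** In the product with a_x (x) 1 the left factor a_x u pairs with a_k only for
    u = 1, so what is left of t is its contraction against 1. *)
Lemma contract_letterM_l k x t :
  contract (letter_gen k) ((basis (fmu x, mone) : tensor D) * t) =
  B (letter_gen x) (letter_gen k) *: contract 1 t.
Proof.
elim/tensor_ind: t => [|c t t' Ht Ht'|[u v]].
- by rewrite mulr0 !contract0 scaler0.
- rewrite mulrDr -scalerAr !contractP Ht Ht' scalerDr !scalerA.
  by rewrite [c * _]mulrC.
rewrite tensor_basisM /= contractZ !contractU /= twist1l scale1r mul1m.
rewrite scalerA; congr (_ *: _).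
rewrite basis_cons formMl rho_letter.
rewrite -[basis (fmu k, mone)]scale1r tensor_formPr !tensor_form_tensl.
by rewrite !basis1 mul1r form_letter1 mul0r addr0.
Qed.

(** Here 1 (x) a_x moves past a left factor u, and only u = a_k survives the
    contraction: the twist is that of a_x and a_k. *)
Lemma contract_letterM_r k x t :
  contract (letter_gen k) ((basis (mone, fmu x) : tensor D) * t) =
  twist (fmu x) (fmu k) *: (letter_gen x * contract (letter_gen k) t).
Proof.
elim/tensor_ind: t => [|c t t' Ht Ht'|[u v]].
- by rewrite mulr0 contract0 mulr0 scaler0.
- rewrite mulrDr -scalerAr !contractP Ht Ht' mulrDr -scalerAr scalerDr !scalerA.
  by rewrite [c * _]mulrC.
rewrite tensor_basisM /= contractZ !contractU /= mul1m (form_word_letter u).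
rewrite basis_cons -scalerAr !scalerA; case: eqP => [-> //|_].
by rewrite !mulr0 !scale0r.
Qed.

Definition letter_pair x k : Qq := B (letter_gen x) (letter_gen k).

Lemma skew_der_letterM k x y : skew_der k (letter_gen x * y) =
  letter_pair x k *: y + letter_twist x k *: (letter_gen x * skew_der k y).
Proof.
rewrite /skew_der rhoM rho_letter mulrDl contractD.
by rewrite contract_letterM_l contract_letterM_r contract_counit.
Qed.

HB.instance Definition _ k := GRing.isLinear.Build Qq (free_alg D) (free_alg D)
  *:%R (skew_der k) (skew_derP k).

Lemma form_letter_neq x k : x != k -> letter_pair x k = 0.
Proof. by move=> xk; rewrite /letter_pair form_gen (negbTE xk). Qed.
End SkewDerivations.

(** * Serre sums *)

Lemma q_expn_neq1 n : (0 < n)%N -> q ^+ n != 1.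
Proof.
move=> n_gt0; rewrite /q -rmorphXn -(rmorph1 (@tofrac _)) tofrac_eq.
apply/eqP => /(congr1 (fun s : {poly rat} => size s)).
by rewrite size_polyXn size_poly1 => -[n0]; rewrite n0 in n_gt0.
Qed.

(** The following notations render the scalars of the construction: v is the
    twist of a_i with itself, and E ^+ n the twist of a_i with an element of
    weight n alpha_j. *)
Section SerreRelations.
Context (I : countType) (D : borcherds_cartan I) (B : bialgebra_form D).
Context (i j : I) (i_real : real_index D i).
Local Notation Q := (qi D i).
Local Notation P := ((-1) ^+ parity D i : Qq).
Local Notation v := (P * Q ^+ 2).
Local Notation E := ((-1) ^+ (parity D i * parity D j)%N * Q ^ D i j).

Lemma is_letter_real : is_letter D (i, 1%N).
Proof. by rewrite /is_letter i_real. Qed.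

Definition real_letter : letter D := exist _ (i, 1%N) is_letter_real.

Lemma gen_real : gen D i 1 = letter_gen real_letter.
Proof. exact: gen_letter. Qed.

Lemma letter_twist_real : letter_twist real_letter real_letter = v.
Proof.
rewrite letter_twistE /letter_parity /letter_index /letter_level /= mul1n oddb.
have -> : D i i = 2 by apply/eqP.
rewrite mulr1 mulnb andbb; congr (_ * _).
by rewrite /qi -exprM exprnP PoszM mulr1.
Qed.

Lemma letter_twist_realr x :
  letter_index x = j -> letter_twist x real_letter = E ^+ letter_level x.
Proof.
move=> xj; rewrite letter_twistE exprM letter_parityE xj.
rewrite /letter_parity /letter_index /letter_level /= mul1n oddb mulr1.
rewrite [E ^+ _]exprMn (exprnP (Q ^ _)) exprz_exp.
rewrite /qi (exprnP q) exprz_exp mulrA -(cartan_sym D i j); congr (_ * _).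
by rewrite -!exprM; congr (_ ^+ _); rewrite mulnC mulnCA mulnC.
Qed.

Lemma letter_twist_reall x :
  letter_index x = j -> letter_twist real_letter x = E ^+ letter_level x.
Proof.
move=> xj; rewrite -(letter_twist_realr xj) !letter_twistE xj.
rewrite [(letter_parity real_letter * _)%N]mulnC; congr (_ * q ^ _).
by rewrite cartan_sym mulrAC.
Qed.

Lemma v_expn_neq1 n : (0 < n)%N -> v ^+ n != 1.
Proof.
move=> n_gt0; have: v ^+ n ^+ 2 != 1.
  have -> : v ^+ n ^+ 2 = (Q ^+ 2 ^+ 2) ^+ n.
    by rewrite exprAC [v ^+ 2]exprMn [P ^+ 2]exprAC sqrrN !expr1n mul1r.
  rewrite /qi -!exprM.
  by rewrite q_expn_neq1 // !muln_gt0 symmetrizer_gt0 n_gt0.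
by apply: contra_neq => ->; rewrite expr1n.
Qed.

Lemma qi_neq0 : Q != 0.
Proof. by rewrite expf_neq0 // q_neq0. Qed.

Lemma qint_geometric n : \sum_(t < n.+1) v ^+ t = Q ^+ n * qint D i n.+1.
Proof.
apply: geometric_sum_qint qi_neq0 _; rewrite -[v]expr1; exact: v_expn_neq1.
Qed.

(** The divided powers would be 0 by convention if some [n]_i vanished; it does
    not, because v is not a root of unity. *)
Lemma qint_neq0 n : qint D i n.+1 != 0.
Proof.
have: v ^+ n.+1 - 1 != 0 by rewrite subr_eq0 v_expn_neq1.
by rewrite subrX1 qint_geometric; apply: contraNneq => ->; rewrite !mulr0.
Qed.

Lemma qfactS n : qfact D i n.+1 = qfact D i n * qint D i n.+1.
Proof. by rewrite /qfact big_nat_recr. Qed.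

(** The Gaussian integer produced by the q-derivative of a power cancels against
    [r + 1]_i, up to the power of q_i that relates the two. *)
Lemma skew_der_divided_power r :
  skew_der B real_letter (divided_power D i r.+1) =
  (letter_pair B real_letter real_letter * Q ^+ r) *: divided_power D i r.
Proof.
rewrite /divided_power gen_real linearZ /=.
rewrite (der_genX (skew_der1 B) (skew_der_letterM B)) /= !scalerA.
rewrite letter_twist_real qint_geometric qfactS.
by rewrite mulf_div_cancelr // qint_neq0.
Qed.

Lemma skew_der_divided_power0 k : skew_der B k (divided_power D i 0) = 0.
Proof. by rewrite /divided_power expr0 linearZ /= skew_der1 scaler0. Qed.

Lemma skew_der_divided_power_neq k r :
  real_letter != k -> skew_der B k (divided_power D i r) = 0.
Proof.
move=> ik; rewrite /divided_power gen_real linearZ /=.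
suff -> : skew_der B k (letter_gen real_letter ^+ r) = 0 by rewrite scaler0.
elim: r => [|r IHr]; first by rewrite expr0 skew_der1.
rewrite exprS skew_der_letterM IHr mulr0 scaler0 addr0.
by rewrite form_letter_neq // scale0r.
Qed.

Lemma twisted_leibniz_divided_power k r :
  twisted_leibniz (skew_der B) k (letter_twist real_letter k ^+ r)
    (divided_power D i r).
Proof.
rewrite /divided_power gen_real.
apply: twisted_leibnizZ; apply: twisted_leibnizX; first exact: skew_der1.
apply: twisted_leibniz_gen; [exact: skew_der1 | exact: skew_der_letterM].
Qed.

Lemma form_divided_power1 r : B (divided_power D i r.+1) 1 = 0.
Proof.
rewrite /divided_power gen_real formZl.
by rewrite exprS formMr_one form_letter1 mul0r mulr0.
Qed.

Local Notation a := (D i j).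
Local Notation coef := (serre_coef Q a (parity D i) (parity D j)).
Local Notation span := (level_span (@letter_gen I D) (@letter_index I D)
  (@letter_level I D) j).

Definition serre_sum m n y : free_alg D :=
  sandwich_sum (divided_power D i) (coef m n) m y.

Hypothesis ij : i != j.

Lemma skew_der_span n y k : span n y -> skew_der B k y = 0 \/
  letter_index k = j /\
  exists2 n', n = (letter_level k + n')%N & span n' (skew_der B k y).
Proof.
apply: der_level_span; [exact: form_letter_neq | exact: skew_der1 |].
exact: skew_der_letterM.
Qed.

Lemma even_cartan : parity D i -> (2 %| a)%Z.
Proof. exact: cartan_even. Qed.

(** The scalar vanishes when n a_ij + m = 0, which is where a Serre sum would
    leave the range m > - n a_ij. In the sum, d_i kills the middle factor, since
    its letters have index j. *)
Lemma skew_der_serre_sum_real m n y : span n y ->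
  skew_der B real_letter (serre_sum m.+1 n y) =
  (letter_pair B real_letter real_letter *
    (((-1) ^+ (parity D i * parity D j)%N) ^+ n *
    (Q ^ (n%:Z * a + m%:Z) - P ^+ m * Q ^ (- (n%:Z * a + m%:Z))))) *:
  serre_sum m n y.
Proof.
move=> Hy.
have dy : skew_der B real_letter y = 0.
  by case: (skew_der_span real_letter Hy) => // -[ji]; case/eqP: ij.
have Ly : twisted_leibniz (skew_der B) real_letter (E ^+ n) y.
  exact: (twisted_leibniz_level_span (skew_der1 B) (skew_der_letterM B)
    letter_twist_realr).
rewrite /serre_sum (der_sandwich_sum_outer _ _ dy Ly (skew_der_divided_power0 _)
  skew_der_divided_power (twisted_leibniz_divided_power _)).
rewrite -scalerA; congr (_ *: _); rewrite -sandwich_sumZ.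
apply: eq_sandwich_sum => r le_rm.
by rewrite letter_twist_real (serre_coef_lower _ qi_neq0 even_cartan).
Qed.

Lemma skew_der_serre_sum_neq k m n n' y :
  real_letter != k -> letter_index k = j -> n = (letter_level k + n')%N ->
  skew_der B k (serre_sum m n y) = serre_sum m n' (skew_der B k y).
Proof.
move=> ik kj ->.
rewrite /serre_sum (der_sandwich_sum_middle (@letter_gen_ind _ D) (skew_der1 B)
  (skew_der_letterM B) _ _ _ (fun r => skew_der_divided_power_neq r ik)
  (twisted_leibniz_divided_power k)).
apply: eq_sandwich_sum => r _.
rewrite letter_twist_reall // serre_coef_level ?qi_neq0 //.
exact: even_cartan.
Qed.

Lemma skew_der_serre_sum_const k m n y :
  real_letter != k -> skew_der B k y = 0 ->
  skew_der B k (serre_sum m n y) = 0.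
Proof.
move=> ik dy.
rewrite /serre_sum (der_sandwich_sum_middle (@letter_gen_ind _ D) (skew_der1 B)
  (skew_der_letterM B) _ _ _ (fun r => skew_der_divided_power_neq r ik)
  (twisted_leibniz_divided_power k)).
by rewrite /= dy; apply: big1 => r _; rewrite mulr0 mul0r scaler0.
Qed.

Lemma form_serre_sum1 m n y : (0 < m)%N -> B (serre_sum m n y) 1 = 0.
Proof.
move=> m_gt0; rewrite /serre_sum /sandwich_sum.
apply: (big_ind (fun s => B s 1 = 0)) => [|s t Hs Ht|r _].
- exact: Defs.form0l.
- by rewrite -[s]scale1r formPl Hs Ht mulr0 addr0.
rewrite formZl (formMr_one B (divided_power D i r * y)).
rewrite (formMr_one B (divided_power D i r)).
have power1 s : (0 < s)%N -> B (divided_power D i s) 1 = 0.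
  by case: s => // s _; apply: form_divided_power1.
have mul_eq0 (K : fieldType) (e x t z : K) :
    x = 0 \/ z = 0 -> e * (x * t * z) = 0.
  by case=> ->; rewrite ?mul0r !mulr0.
apply: mul_eq0; have [->|r_gt0] := posnP r; last by left; apply: power1.
by right; rewrite subn0; apply: power1.
Qed.

(** Induction on the test word w, for all Serre sums in the range m > - n a_ij
    at once: stripping the first letter of w yields 0 or another such sum. *)
Lemma form_serre_sum w m n y : span n y -> (0 < m)%N -> - a * n%:Z < m%:Z ->
  B (serre_sum m n y) (basis w) = 0.
Proof.
elim/word_ind: w m n y => [|k w IHw] m n y Hy m_gt0 lt_m.
  by rewrite basis1 form_serre_sum1.
rewrite basis_cons skew_der_dual.
have [<-|ik] := eqVneq real_letter k.
  case: m m_gt0 lt_m => // m _ lt_m.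
  rewrite (skew_der_serre_sum_real _ Hy) formZl.
  have a_le0 : a <= 0 by exact: cartan_offdiag.
  have := lt_m; rewrite intS ltz1D le_eqVlt => /orP[/eqP Em|lt_m'].
    (* the boundary case n a + m = 0: the scalar is 1 - P ^+ m, and m is even if
       i is odd *)
    have -> : n%:Z * a + m%:Z = 0 by rewrite -Em; ring.
    have -> : P ^+ m = 1.
      case: (parity D i) even_cartan => [/(_ isT)/dvdzP[a' Ea]|_]; last first.
        by rewrite expr1n.
      rewrite expr1 -signr_odd.
      suff -> : odd m = false by [].
      move: Em; rewrite Ea; lia.
    by rewrite oppr0 expr0z mul1r subrr !mulr0 mul0r.
  rewrite IHw ?mulr0 //; nia.
have [dy|[kj [n' En Hdy]]] := skew_der_span k Hy.
  by rewrite skew_der_serre_sum_const // Defs.form0l.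
rewrite (skew_der_serre_sum_neq _ _ ik kj En); apply: IHw => //.
have a_le0 : a <= 0 by exact: cartan_offdiag.
apply: le_lt_trans lt_m; rewrite En PoszD; nia.
Qed.

Lemma serre_sum_radical m n y : span n y -> (0 < m)%N -> - a * n%:Z < m%:Z ->
  serre_sum m n y \in form_radical B.
Proof.
move=> Hy m_gt0 lt_m; apply/form_radicalP.
elim/free_alg_ind=> [|c y1 y2 H1 H2|w].
- exact: Defs.form0r.
- by rewrite formPr H1 H2 mulr0 addr0.
exact: form_serre_sum.
Qed.

Lemma serre_elementE m n c :
  serre_element D i j m n c = serre_sum m n (middle_factor D j n c).
Proof. by []. Qed.

End SerreRelations.

Lemma toUplus_radical (I : countType) (D : borcherds_cartan I)
    (B : bialgebra_form D) x : x \in form_radical B -> toUplus B x = 0.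
Proof.
move=> rad_x; have : x - 0 \in form_radical B by rewrite subr0.
move=> /quot_piP E; rewrite -[RHS](linear0 (toUplus B)).
exact: E.
Qed.

Lemma level_span_middle_factor (I : countType) (D : borcherds_cartan I)
    (j : I) (n : nat) (c : seq nat) :
  (imaginary_index D j -> all (fun l => 0 < l)%N c /\ sumn c = n) ->
  level_span (@letter_gen I D) (@letter_index I D) (@letter_level I D) j n
    (middle_factor D j n c).
Proof.
move=> imag_c; rewrite /middle_factor; case: ifP => [j_real|j_real].
  apply: level_spanZ; rewrite (gen_real j_real).
  elim: n {imag_c} => [|n IHn]; first exact: level_span1.
  by rewrite exprS -add1n; apply: (level_spanM (x := real_letter j_real)).
have j_imag : imaginary_index D j.
  by case: (cartan_diag D j) => [/eqP|[]//]; rewrite -/(real_index D j) j_real.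
have [c_gt0 <-] := imag_c j_imag.
elim: c c_gt0 {imag_c} => [_|l c IHc /= /andP[l_gt0 /IHc Hc]].
  by rewrite big_nil; apply: level_span1.
have jl : is_letter D (j, l) by rewrite /is_letter j_imag l_gt0 orbT.
rewrite big_cons (gen_letter jl).
exact: (level_spanM (x := exist _ (j, l) jl)).
Qed.

Theorem theorem1p11 (I : countType) (D : borcherds_cartan I)
    (B : bialgebra_form D) (i j : I) (m n : nat) (c : seq nat) :
  real_index D i -> i != j ->
  (0 < m)%N -> - D i j * n%:Z < m%:Z ->
  (imaginary_index D j -> all (fun l => 0 < l)%N c /\ sumn c = n) ->
  toUplus B (serre_element D i j m n c) = 0.
Proof.
move=> i_real ij m_gt0 lt_m imag_c.
have Hy := level_span_middle_factor imag_c.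
have := serre_sum_radical B i_real ij Hy m_gt0 lt_m.
rewrite -serre_elementE; exact: toUplus_radical.
Qed.
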